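(* Let $p$ and $q$ be integers such that $p\le -2$, $q\ge4$ and $q>|p|+1$. For $s\in\{\alpha,\beta\}$ put $$A^{\pm}_s=\sqrt[3]{s^q}\,\frac{\sqrt[3]{s^q F_p}\pm\sqrt[3]{F_{p+q}}}{s^qF_p+F_{p+q}}.$$ Then $$\begin{aligned}\frac{\sqrt5}{\sqrt[3]{F_pF_{p+q}}}\sum_{k = 1}^\infty \Big(\frac{-27F_p F_{p + q}}{F_q^2} \Big)^{k} \frac{F_{(2p + q)k}}{k\binom{3k}{k}} &= 2\sqrt{3}\Bigg(A^{-}_{\alpha} \arctan \bigg( \frac{\sqrt 3\,\sqrt[3]{F_{p + q}}}{2\sqrt[3]{\alpha^q F_p} + \sqrt[3]{F_{p + q}} } \bigg) + A^{-}_{\beta} \arctan \bigg( \frac{\sqrt 3\sqrt[3]{F_p}}{2(-1)^q\sqrt[3]{\alpha^qF_{p+q}} + \sqrt[3]{F_{p}} } \bigg)\Bigg)\\ &\quad -\Bigg( A^{+}_{\alpha}\log\bigg( \frac{\beta^pF_q}{\big(\sqrt[3]{F_{p + q}}- \sqrt[3]{\alpha^q F_p} \big)^3 }\bigg) - A^+_{\beta}\log\bigg( \frac{\alpha^p F_q}{\big(\sqrt[3]{F_{p + q}} - \sqrt[3]{\beta^qF_p}\big)^3} \bigg) \Bigg),\end{aligned}$$ and $$\begin{aligned}\frac{1}{\sqrt[3]{F_pF_{p+q}}}\sum_{k = 1}^\infty \Big(\frac{-27F_p F_{p + q}}{F_q^2} \Big)^{k} \frac{L_{(2p + q)k}}{k\binom{3k}{k}}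 &= 2\sqrt 3\, \Bigg(A^{-}_{\alpha} \arctan \bigg( \frac{\sqrt 3\,\sqrt[3]{F_{p + q}}}{2\sqrt[3]{\alpha^q F_p} + \sqrt[3]{F_{p + q}} } \bigg) -A^{-}_{\beta} \arctan \bigg( \frac{\sqrt 3 \sqrt[3]{F_p}}{2(-1)^q\sqrt[3]{\alpha^qF_{p+q}} + \sqrt[3]{F_{p}} } \bigg) \Bigg)\\ &\quad - \Bigg( A^{+}_{\alpha}\log\bigg( \frac{\beta^pF_q}{\big(\sqrt[3]{F_{p + q}}- \sqrt[3]{\alpha^q F_p} \big)^3 }\bigg) + A^+_{\beta}\log\bigg( \frac{\alpha^p F_q}{\big(\sqrt[3]{F_{p + q}} - \sqrt[3]{\beta^qF_p}\big)^3} \bigg) \Bigg).\end{aligned}$$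
   Context: $F_n$ and $L_n$ are the Fibonacci and Lucas numbers, defined by $F_0=0$, $F_1=1$, $L_0=2$, $L_1=1$, $X_n=X_{n-1}+X_{n-2}$, and extended to negative indices by $F_{-j}=(-1)^{j-1}F_j$, $L_{-j}=(-1)^jL_j$. $\alpha=(1+\sqrt5)/2$, $\beta=(1-\sqrt5)/2$. $\sqrt[3]{t}$ denotes the real cube root (negative for $t<0$). *)

(* Defs.v *)
From Stdlib Require Import Reals ZArith.
From Coquelicot Require Import Coquelicot.
Open Scope R_scope.

Fixpoint fibn (n : nat) : R :=
  match n with
  | O => 0
  | S m => match m with O => 1 | S k => fibn m + fibn k end
  end.
Fixpoint lucn (n : nat) : R :=
  match n with
  | O => 2
  | S m => match m with O => 1 | S k => lucn m + lucn k end
  end.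

Definition Fib (n : Z) : R :=
  if Z.leb 0 n then fibn (Z.to_nat n)
  else (-1) ^ (Z.to_nat (- n) - 1) * fibn (Z.to_nat (- n)).
Definition Luc (n : Z) : R :=
  if Z.leb 0 n then lucn (Z.to_nat n)
  else (-1) ^ (Z.to_nat (- n)) * lucn (Z.to_nat (- n)).

Definition alpha : R := (1 + sqrt 5) / 2.
Definition beta : R := (1 - sqrt 5) / 2.

Definition cbrt (t : R) : R :=
  if Rlt_dec 0 t then Rpower t (1/3)
  else if Rlt_dec t 0 then - Rpower (- t) (1/3)
  else 0.

(* A^{+-}_s ; sg = 1 for +, sg = -1 for - *)
Definition Acoef (p q : Z) (s sg : R) : R :=
  cbrt (powerRZ s q) *
  ((cbrt (powerRZ s q * Fib p) + sg * cbrt (Fib (p + q))) /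
   (powerRZ s q * Fib p + Fib (p + q))).

(* the series term for k >= 1, with X = Fib or Luc *)
Definition term (X : Z -> R) (p q : Z) (k : nat) : R :=
  (-27 * Fib p * Fib (p + q) / (Fib q) ^ 2) ^ k *
  X ((2 * p + q) * Z.of_nat k)%Z / (INR k * Binomial.C (3 * k) k).

Definition atan1 (p q : Z) : R :=
  atan (sqrt 3 * cbrt (Fib (p + q)) /
        (2 * cbrt (powerRZ alpha q * Fib p) + cbrt (Fib (p + q)))).
Definition atan2' (p q : Z) : R :=
  atan (sqrt 3 * cbrt (Fib p) /
        (2 * powerRZ (-1) q * cbrt (powerRZ alpha q * Fib (p + q)) + cbrt (Fib p))).
Definition log1 (p q : Z) : R :=
  ln (powerRZ beta p * Fib q /
      (cbrt (Fib (p + q)) - cbrt (powerRZ alpha q * Fib p)) ^ 3).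
Definition log2 (p q : Z) : R :=
  ln (powerRZ alpha p * Fib q /
      (cbrt (Fib (p + q)) - cbrt (powerRZ beta q * Fib p)) ^ 3).

(* Main.v *)
(** Since 1 / (k binom(3k,k)) is the Beta integral of u^(2k) (1-u)^(k-1) over [0,1],
    the series G(z) = sum z^k / (k binom(3k,k)) is the integral of
    z u^2 / (1 - z u^2 (1-u)) whenever |z| < 27/4. Writing z = -27 t^3 / (1-t^3)^2
    makes the cubic denominator split off the factor 1 + t + t^2 - 3 t u over the reals,
    so the integral is elementary in t. By Binet's formula the two series are combinations
    of G at two points, for which t^3 is F_(p+q) / (alpha^q F_p) and beta^q F_p / F_(p+q)
    respectively; the identities F_(p+q) - alpha^q F_p = beta^p F_q and its conjugate
    identify both values of z. The map t -> 1/t leaves z unchanged, which is why the root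
    with |t| < 1 can be chosen in both cases. *)

Require Import Defs.
From Stdlib Require Import Reals ZArith Lra Lia.
From Coquelicot Require Import Coquelicot.
Open Scope R_scope.

(** * Beta integrals and the integral representation of the series *)

(** Induction on [b]: integration by parts trades one factor 1 - u for one factor u, so the exponent
    [a] has to stay general in the induction hypothesis. *)
Lemma is_RInt_beta (a b : nat) :
  is_RInt (fun u => u ^ a * (1 - u) ^ b) 0 1
    (INR (fact a) * INR (fact b) / INR (fact (a + b + 1))).
Proof.
  revert a; induction b as [|b IH]; intro a.
  - assert (Ha : INR (fact a) <> 0) by apply INR_fact_neq_0.
    assert (Ha' : INR (S a) <> 0) by (apply not_0_INR; lia).
    replace (INR (fact a) * INR (fact 0) / INR (fact (a + 0 + 1)))
      with (minus (1 ^ S a / INR (S a)) (0 ^ S a / INR (S a))).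
    + apply (is_RInt_derive (fun u => u ^ S a / INR (S a))).
      * intros x _; auto_derive; [trivial|].
        change (pred (S a)) with a. rewrite pow_O. field. exact Ha'.
      * intros x _. apply (ex_derive_continuous (V := R_NormedModule)).
        auto_derive; trivial.
    + replace (a + 0 + 1)%nat with (S a) by lia.
      rewrite fact_simpl, mult_INR, pow1.
      rewrite pow_i by lia. change (INR (fact 0)) with 1.
      change (1 / INR (S a) - 0 / INR (S a) = INR (fact a) * 1 / (INR (S a) * INR (fact a))).
      field. auto.
  - assert (Ha : INR (fact a) <> 0) by apply INR_fact_neq_0.
    assert (Ha' : INR (S a) <> 0) by (apply not_0_INR; lia).
    assert (Hab : INR (fact (a + S b + 1)) <> 0) by apply INR_fact_neq_0.
    (* This integrand is the derivative of u^(a+1) (1-u)^(b+1) / (a+1). Both exponents are positive,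
       so the boundary terms vanish and only the multiple of the integral from [IH] survives. *)
    assert (H : is_RInt (fun u => u ^ a * (1 - u) ^ S b
                  - INR (S b) / INR (S a) * (u ^ S a * (1 - u) ^ b)) 0 1
                (minus (1 ^ S a * (1 - 1) ^ S b / INR (S a))
                       (0 ^ S a * (1 - 0) ^ S b / INR (S a)))).
    { apply (is_RInt_derive (fun u => u ^ S a * (1 - u) ^ S b / INR (S a))).
      - intros x _; auto_derive; [trivial|].
        change (pred (S a)) with a. change (pred (S b)) with b.
        change (x ^ S a) with (x * x ^ a).
        change ((1 - x) ^ S b) with ((1 - x) * (1 - x) ^ b).
        change (1 + - x) with (1 - x).
        change (match a with O => 1 | S _ => INR a + 1 end) with (INR (S a)).
        change (match b with O => 1 | S _ => INR b + 1 end) with (INR (S b)).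
        field. exact Ha'.
      - intros x _. apply (ex_derive_continuous (V := R_NormedModule)).
        auto_derive; trivial. }
    pose proof (is_RInt_plus _ _ _ _ _ _ H
      (is_RInt_scal _ _ _ (INR (S b) / INR (S a)) _ (IH (S a)))) as K.
    eapply is_RInt_ext; [|].
    2:{ match type of K with is_RInt _ _ _ ?l => match goal with |- is_RInt _ _ _ ?l' =>
          replace l' with l end end; [exact K|].
        change ((1 ^ S a * (1 - 1) ^ S b / INR (S a) - 0 ^ S a * (1 - 0) ^ S b / INR (S a))
          + INR (S b) / INR (S a) * (INR (fact (S a)) * INR (fact b) / INR (fact (S a + b + 1)))
          = INR (fact a) * INR (fact (S b)) / INR (fact (a + S b + 1))).
        replace (S a + b + 1)%nat with (a + S b + 1)%nat by lia.
        rewrite Rminus_diag, !pow_i, (fact_simpl a), (fact_simpl b), !mult_INR by lia.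
        field. auto. }
    intros u _. unfold plus, scal; simpl; unfold mult; simpl. ring.
Qed.

(** With k = n + 1 the Beta value is (2k)! (k-1)! / (3k)!; the exponent k - 1 of 1 - u becomes
    [n]. *)
Lemma is_RInt_inv_binom (n : nat) :
  is_RInt (fun u => u ^ (2 * S n) * (1 - u) ^ n) 0 1
    (/ (INR (S n) * Binomial.C (3 * S n) (S n))).
Proof.
  replace (/ (INR (S n) * Binomial.C (3 * S n) (S n)))
    with (INR (fact (2 * S n)) * INR (fact n) / INR (fact (2 * S n + n + 1)));
    [apply is_RInt_beta|].
  unfold Binomial.C.
  replace (3 * S n - S n)%nat with (2 * S n)%nat by lia.
  replace (2 * S n + n + 1)%nat with (3 * S n)%nat by lia.
  rewrite (fact_simpl n), mult_INR.
  pose proof (INR_fact_neq_0 n). pose proof (INR_fact_neq_0 (2 * S n)).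
  pose proof (INR_fact_neq_0 (3 * S n)).
  assert (INR (S n) <> 0) by (apply not_0_INR; lia).
  field. auto.
Qed.

(** Under the integral the series is geometric with ratio r = z u^2 (1-u). Since u^2 (1-u) is at
    most 4/27 on [0,1], the condition on [z] bounds |r| by a constant [rho] < 1, and the partial
    sums converge to the integral at a geometric rate. *)
Lemma is_series_inv_binom_RInt (z I : R) :
  Rabs z < 27 / 4 ->
  is_RInt (fun u => z * u ^ 2 / (1 - z * (u ^ 2 * (1 - u)))) 0 1 I ->
  is_series (fun n => z ^ S n / (INR (S n) * Binomial.C (3 * S n) (S n))) I.
Proof.
  intros Hz HI.
  set (a := fun n : nat => z ^ S n / (INR (S n) * Binomial.C (3 * S n) (S n))).
  set (rho := Rabs z * (4 / 27)).
  assert (Hrho : 0 <= rho < 1) by (unfold rho; pose proof (Rabs_pos z); lra).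
  assert (Hr : forall u, 0 <= u <= 1 -> Rabs (z * (u ^ 2 * (1 - u))) <= rho).
  { intros u Hu. rewrite Rabs_mult. apply Rmult_le_compat_l; [apply Rabs_pos|].
    rewrite Rabs_pos_eq.
    (* The maximum of u^2 (1-u) is at u = 2/3: 27 (4/27 - u^2 (1-u)) = (3u-2)^2 (3u+1). *)
    - assert (0 <= (3 * u - 2) ^ 2 * (3 * u + 1)) by
        (apply Rmult_le_pos; [apply pow2_ge_0|lra]). nra.
    - apply Rmult_le_pos; [apply pow2_ge_0|lra]. }
  set (M := Rabs z / (1 - rho)).
  (* The finite geometric sum is kept in closed form, so that the remainder is the full integrand
     times r^(n+1), which [M * rho ^ S n] bounds uniformly in u. *)
  assert (Hpart : forall n, is_RInt (fun u =>
            z * u ^ 2 / (1 - z * (u ^ 2 * (1 - u))) * (1 - (z * (u ^ 2 * (1 - u))) ^ S n))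
            0 1 (sum_n a n)).
  { assert (Hstep : forall n, is_RInt (fun u => z * u ^ 2 * (z * (u ^ 2 * (1 - u))) ^ n)
              0 1 (a n)).
    { intro n. apply (is_RInt_ext (fun u => scal (z ^ S n) (u ^ (2 * S n) * (1 - u) ^ n))).
      - intros u _.
        change (z ^ S n * (u ^ (2 * S n) * (1 - u) ^ n)
                = z * u ^ 2 * (z * (u ^ 2 * (1 - u))) ^ n).
        rewrite pow_mult, !Rpow_mult_distr, <- !tech_pow_Rmult. ring.
      - apply (is_RInt_scal (V := R_NormedModule)). apply is_RInt_inv_binom. }
    assert (Hden : forall u, 0 <= u <= 1 -> 1 - z * (u ^ 2 * (1 - u)) <> 0).
    { intros u Hu. specialize (Hr u Hu). apply Rabs_le_between in Hr. lra. }
    assert (Hin : forall u, Rmin 0 1 < u < Rmax 0 1 -> 0 <= u <= 1).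
    { intros u Hu. rewrite Rmin_left, Rmax_right in Hu; lra. }
    induction n as [|n IH].
    - rewrite sum_O. eapply is_RInt_ext; [|apply Hstep].
      intros u Hu. cbv beta. field_simplify; [reflexivity|].
      specialize (Hden u (Hin u Hu)). contradict Hden. lra.
    - rewrite sum_Sn. eapply is_RInt_ext; [|exact (is_RInt_plus _ _ _ _ _ _ IH (Hstep (S n)))].
      intros u Hu. specialize (Hden u (Hin u Hu)).
      set (r := z * (u ^ 2 * (1 - u))) in *.
      change (z * u ^ 2 / (1 - r) * (1 - r ^ S n) + z * u ^ 2 * r ^ S n =
        z * u ^ 2 / (1 - r) * (1 - r * r ^ S n)). field. exact Hden. }
  assert (Herr : forall n, Rabs (I - sum_n a n) <= M * rho ^ S n).
  { intro n. pose proof (is_RInt_minus _ _ _ _ _ _ HI (Hpart n)) as H.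
    replace (M * rho ^ S n) with ((1 - 0) * (M * rho ^ S n)) by ring.
    apply (norm_RInt_le_const _ 0 1 _ _ Rle_0_1) with (2 := H).
    intros u Hu. specialize (Hr u Hu).
    set (r := z * (u ^ 2 * (1 - u))) in *.
    change (Rabs (z * u ^ 2 / (1 - r) - z * u ^ 2 / (1 - r) * (1 - r ^ S n)) <= M * rho ^ S n).
    replace (z * u ^ 2 / (1 - r) - z * u ^ 2 / (1 - r) * (1 - r ^ S n))
      with (z * u ^ 2 / (1 - r) * r ^ S n) by ring.
    rewrite Rabs_mult, <- RPow_abs.
    apply Rmult_le_compat; try apply Rabs_pos; [apply pow_le, Rabs_pos| |].
    2:{ apply pow_incr. split; [apply Rabs_pos|exact Hr]. }
    unfold Rdiv, M. rewrite Rabs_mult, Rabs_mult.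
    assert (1 - rho <= 1 - r) by (apply Rabs_le_between in Hr; lra).
    apply Rmult_le_compat; try apply Rabs_pos.
    - apply Rmult_le_pos; apply Rabs_pos.
    - rewrite <- (Rmult_1_r (Rabs z)) at 2. apply Rmult_le_compat_l; [apply Rabs_pos|].
      rewrite Rabs_pos_eq; nra.
    - rewrite Rabs_pos_eq.
      + apply Rinv_le_contravar; lra.
      + left; apply Rinv_0_lt_compat; lra. }
  assert (Hgeom : is_lim_seq (fun n => M * rho ^ S n) 0).
  { replace (Finite 0) with (Rbar_mult M 0) by (simpl; f_equal; ring).
    apply is_lim_seq_scal_l.
    apply (is_lim_seq_incr_1 (fun n => rho ^ n)). apply is_lim_seq_geom.
    rewrite Rabs_pos_eq; lra. }
  change (is_lim_seq (sum_n a) I).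
  apply is_lim_seq_le_le with (u := fun n => I - M * rho ^ S n) (w := fun n => I + M * rho ^ S n).
  - intro n. specialize (Herr n). apply Rabs_le_between in Herr. lra.
  - replace I with (I - 0) at 1 by ring. apply is_lim_seq_minus'; [apply is_lim_seq_const|exact Hgeom].
  - replace I with (I + 0) at 1 by ring. apply is_lim_seq_plus'; [apply is_lim_seq_const|exact Hgeom].
Qed.

(** * Closed form of the integral and of the series *)

Lemma is_derive_atan_comp (g : R -> R) (x l : R) :
  is_derive g x l -> is_derive (fun u => atan (g u)) x (l / (1 + g x ^ 2)).
Proof.
  intro H. apply (is_derive_comp atan g x (/ (1 + g x ^ 2)) l); [|exact H].
  apply is_derive_Reals, derivable_pt_lim_atan.
Qed.

(* With theta the arctangent on the right (the argument of 1 + t e^(i pi/3)), the two on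
   the left are pi/6 + 2 theta and pi/6 - theta. *)
Lemma atan_diff_triple (t : R) : -1 < t < 1 ->
  atan ((6 * t * 1 + (1 - t) ^ 2) / (sqrt 3 * (1 - t ^ 2)))
  - atan ((6 * t * 0 + (1 - t) ^ 2) / (sqrt 3 * (1 - t ^ 2)))
  = 3 * atan (sqrt 3 * t / (2 + t)).
Proof.
  intro Ht.
  assert (Hs : 0 < sqrt 3) by (apply sqrt_lt_R0; lra).
  assert (Hss : sqrt 3 ^ 2 = 3) by (simpl; rewrite Rmult_1_r; apply sqrt_sqrt; lra).
  set (s := sqrt 3) in *; clearbody s.
  (* Differentiation avoids following the branches of the arctangent: with M = 1 + x + x^2 the three
     arctangents have derivatives s/M, -s/(2M) and s/(2M), so [f] is constant on (-1,1). At 0 the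
     first two coincide and the third vanishes. *)
  set (f := fun t => atan ((6 * t * 1 + (1 - t) ^ 2) / (s * (1 - t ^ 2)))
    - atan ((6 * t * 0 + (1 - t) ^ 2) / (s * (1 - t ^ 2))) - 3 * atan (s * t / (2 + t))).
  assert (Hd : forall x, -1 < x < 1 -> is_derive f x 0).
  { intros x Hx.
    assert (Hx2 : 0 < 1 - x ^ 2) by nra.
    assert (Hm : 0 < 1 + x + x ^ 2) by nra.
    assert (Hsd : s * (1 - x ^ 2) <> 0) by nra.
    assert (D1 : is_derive (fun t => atan ((6 * t * 1 + (1 - t) ^ 2) / (s * (1 - t ^ 2)))) x
                  (s / (1 + x + x ^ 2))).
    { replace (s / (1 + x + x ^ 2)) with (4 * (1 + x + x ^ 2) / (s * (1 - x ^ 2) ^ 2) /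
          (1 + ((6 * x * 1 + (1 - x) ^ 2) / (s * (1 - x ^ 2))) ^ 2)).
      - apply (is_derive_atan_comp (fun t => (6 * t * 1 + (1 - t) ^ 2) / (s * (1 - t ^ 2)))).
        auto_derive; [exact Hsd|]. field. lra.
      - replace (1 + ((6 * x * 1 + (1 - x) ^ 2) / (s * (1 - x ^ 2))) ^ 2)
          with (4 * (1 + x + x ^ 2) ^ 2 / (3 * (1 - x ^ 2) ^ 2)).
        + rewrite <- Hss at 1. field. lra.
        + rewrite <- Hss at 1. field_simplify_eq; [ring [Hss]|lra]. }
    assert (D2 : is_derive (fun t => atan ((6 * t * 0 + (1 - t) ^ 2) / (s * (1 - t ^ 2)))) x
                  (- s / (2 * (1 + x + x ^ 2)))).
    { replace (- s / (2 * (1 + x + x ^ 2))) with (- 2 / (s * (1 + x) ^ 2) /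
          (1 + ((6 * x * 0 + (1 - x) ^ 2) / (s * (1 - x ^ 2))) ^ 2)).
      - apply (is_derive_atan_comp (fun t => (6 * t * 0 + (1 - t) ^ 2) / (s * (1 - t ^ 2)))).
        auto_derive; [exact Hsd|]. field. lra.
      - replace (1 + ((6 * x * 0 + (1 - x) ^ 2) / (s * (1 - x ^ 2))) ^ 2)
          with (4 * (1 + x + x ^ 2) / (3 * (1 + x) ^ 2)).
        + rewrite <- Hss at 1. field. lra.
        + rewrite <- Hss at 1. field_simplify_eq; [ring [Hss]|lra]. }
    assert (D3 : is_derive (fun t => atan (s * t / (2 + t))) x
                  (s / (2 * (1 + x + x ^ 2)))).
    { replace (s / (2 * (1 + x + x ^ 2))) with (2 * s / (2 + x) ^ 2 /
          (1 + (s * x / (2 + x)) ^ 2)).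
      - apply (is_derive_atan_comp (fun t => s * t / (2 + t))).
        auto_derive; [lra|]. field. lra.
      - replace (1 + (s * x / (2 + x)) ^ 2) with (4 * (1 + x + x ^ 2) / (2 + x) ^ 2).
        + field. lra.
        + field_simplify_eq; [ring [Hss]|lra]. }
    replace 0 with (s / (1 + x + x ^ 2) - - s / (2 * (1 + x + x ^ 2))
                    - 3 * (s / (2 * (1 + x + x ^ 2)))) by (field; lra).
    exact (is_derive_minus _ _ _ _ _ (is_derive_minus _ _ _ _ _ D1 D2)
             (is_derive_scal _ _ 3 _ D3)). }
  assert (Hf0 : f 0 = 0).
  { unfold f. replace (s * 0 / (2 + 0)) with 0 by field.
    rewrite atan_0.
    replace (6 * 0 * 1) with (6 * 0 * 0) by ring. ring. }
  assert (Hft : f t = 0).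
  { rewrite <- Hf0. destruct (Rtotal_order t 0) as [H|[H|H]].
    - apply eq_is_derive; [intros; apply Hd; lra|exact H].
    - now rewrite H.
    - symmetry. apply eq_is_derive; [intros; apply Hd; lra|exact H]. }
  unfold f in Hft. lra.
Qed.

Lemma is_RInt_inv_binom_kernel (t : R) : -1 < t < 1 ->
  let z := -27 * t ^ 3 / (1 - t ^ 3) ^ 2 in
  is_RInt (fun u => z * u ^ 2 / (1 - z * (u ^ 2 * (1 - u)))) 0 1
    (2 * sqrt 3 * (t * (1 - t) / (1 + t ^ 3)) * atan (sqrt 3 * t / (2 + t))
     - t * (1 + t) / (1 + t ^ 3) * ln ((1 - t ^ 3) / (1 - t) ^ 3)).
Proof.
  intros Ht z.
  assert (Hs : 0 < sqrt 3) by (apply sqrt_lt_R0; lra).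
  assert (Hss : sqrt 3 ^ 2 = 3) by (simpl; rewrite Rmult_1_r; apply sqrt_sqrt; lra).
  (* Up to a factor (1 - t^3)^2 the denominator is (m - 3 t u) Q(u), and Phi comes from
     the partial fraction decomposition. *)
  set (m := 1 + t + t ^ 2). set (n := 1 - t + t ^ 2).
  set (Q := fun u => 9 * t ^ 2 * u ^ 2 + 3 * t * (1 - t) ^ 2 * u + (1 - t) ^ 2 * m).
  set (Phi := fun u => m / (3 * n) * ln (m - 3 * t * u) + (1 - t) ^ 2 / (3 * n) * ln (Q u)
    + 2 * t * (1 - t) / (sqrt 3 * (1 + t) * n)
      * atan ((6 * t * u + (1 - t) ^ 2) / (sqrt 3 * (1 - t ^ 2)))).
  assert (Hm : 0 < m) by (unfold m; nra).
  assert (Hn : 0 < n) by (unfold n; nra).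
  assert (Ht2 : 0 < 1 - t ^ 2) by nra.
  assert (Ht3 : 1 - t ^ 3 = (1 - t) * m) by (unfold m; ring).
  assert (Ht3' : 1 + t ^ 3 = (1 + t) * n) by (unfold n; ring).
  (* Completing the square: 4 Q(u) = (6tu + (1-t)^2)^2 + 3 (1-t^2)^2. The same identity dictates the
     argument of the arctangent in [Phi]. *)
  assert (HQ : forall u, 0 < Q u).
  { intro u. assert (0 <= (6 * t * u + (1 - t) ^ 2) ^ 2) by apply pow2_ge_0.
    assert (0 < (1 - t ^ 2) ^ 2) by nra. unfold Q, m. nra. }
  assert (Hl : forall u, 0 <= u <= 1 -> 0 < m - 3 * t * u).
  { intros u Hu. assert (0 < (1 - t) ^ 2) by nra.
    replace (m - 3 * t * u) with (u * (1 - t) ^ 2 + (1 - u) * m) by (unfold m; ring).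
    assert (0 <= (1 - u) * m) by nra.
    destruct (proj1 Hu) as [Hu0 | <-]; [|lra].
    assert (0 < u * (1 - t) ^ 2) by (apply Rmult_lt_0_compat; lra). lra. }
  assert (Hden : forall u, 1 - z * (u ^ 2 * (1 - u)) = (m - 3 * t * u) * Q u / (1 - t ^ 3) ^ 2).
  { intro u. unfold z, Q. rewrite Ht3. unfold m. field. fold m. nra. }
  assert (Hden0 : forall u, 0 <= u <= 1 -> 1 - z * (u ^ 2 * (1 - u)) <> 0).
  { intros u Hu. rewrite Hden. specialize (HQ u). specialize (Hl u Hu).
    rewrite Ht3. apply Rgt_not_eq, Rdiv_lt_0_compat; [nra|].
    apply pow_lt. nra. }
  match goal with |- is_RInt _ _ _ ?l => replace l with (minus (Phi 1) (Phi 0)) end.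
  - apply (is_RInt_derive Phi).
    + intros u Hu. rewrite Rmin_left, Rmax_right in Hu by lra.
      pose proof (HQ u) as HQu. pose proof (Hl u Hu) as Hlu.
      assert (Da : is_derive
                (fun u => atan ((6 * t * u + (1 - t) ^ 2) / (sqrt 3 * (1 - t ^ 2)))) u
                (3 * sqrt 3 * t * (1 - t ^ 2) / (2 * Q u))).
      { replace (3 * sqrt 3 * t * (1 - t ^ 2) / (2 * Q u)) with
          (6 * t / (sqrt 3 * (1 - t ^ 2)) /
            (1 + ((6 * t * u + (1 - t) ^ 2) / (sqrt 3 * (1 - t ^ 2))) ^ 2)).
        - apply (is_derive_atan_comp (fun u => (6 * t * u + (1 - t) ^ 2) / (sqrt 3 * (1 - t ^ 2)))).
          auto_derive; [trivial|]. field. lra.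
        - replace (1 + ((6 * t * u + (1 - t) ^ 2) / (sqrt 3 * (1 - t ^ 2))) ^ 2)
            with (4 * Q u / (3 * (1 - t ^ 2) ^ 2)).
          + field_simplify_eq; [ring [Hss]|lra].
          + unfold Q, m. field_simplify_eq; [ring [Hss]|lra]. }
      assert (Db : is_derive (fun u => ln (m - 3 * t * u)) u (-3 * t / (m - 3 * t * u))).
      { auto_derive; [exact Hlu|]. field. lra. }
      assert (Dc : is_derive (fun u => ln (Q u)) u ((18 * t ^ 2 * u + 3 * t * (1 - t) ^ 2) / Q u)).
      { unfold Q. auto_derive; [exact HQu|]. field. fold (Q u). lra. }
      replace (z * u ^ 2 / (1 - z * (u ^ 2 * (1 - u)))) with
        (m / (3 * n) * (-3 * t / (m - 3 * t * u))
         + (1 - t) ^ 2 / (3 * n) * ((18 * t ^ 2 * u + 3 * t * (1 - t) ^ 2) / Q u)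
         + 2 * t * (1 - t) / (sqrt 3 * (1 + t) * n) * (3 * sqrt 3 * t * (1 - t ^ 2) / (2 * Q u))).
      * exact (is_derive_plus _ _ _ _ _ (is_derive_plus _ _ _ _ _
           (is_derive_scal _ _ _ _ Db) (is_derive_scal _ _ _ _ Dc)) (is_derive_scal _ _ _ _ Da)).
      * rewrite Hden. unfold z.
        transitivity (-27 * t ^ 3 * u ^ 2 / ((m - 3 * t * u) * Q u)).
        (* The summand 9 t^2 is the contribution of the arctangent: its two factors sqrt 3 cancel,
           leaving (1-t)^2 / (3n) times 9 t^2 / Q(u). *)
        -- transitivity ((m * (-3 * t) * Q u
             + (1 - t) ^ 2 * (18 * t ^ 2 * u + 3 * t * (1 - t) ^ 2 + 9 * t ^ 2) * (m - 3 * t * u))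
             / (3 * n * ((m - 3 * t * u) * Q u))).
           ++ field. lra.
           ++ apply Rmult_eq_reg_r with (3 * n * ((m - 3 * t * u) * Q u)).
              2:{ apply Rgt_not_eq. apply Rmult_lt_0_compat; [lra|]. apply Rmult_lt_0_compat; lra. }
              field_simplify; [|lra|lra]. unfold Q, m, n. ring.
        -- field. rewrite Ht3. repeat split; nra.
    + intros u Hu. rewrite Rmin_left, Rmax_right in Hu by lra.
      apply (ex_derive_continuous (V := R_NormedModule)).
      auto_derive. specialize (Hden0 u Hu). intro E. apply Hden0. rewrite <- E. ring.
  - change (minus (Phi 1) (Phi 0)) with (Phi 1 - Phi 0).
    match goal with |- ?x = ?y => change (@eq R x y) end.
    pose proof (atan_diff_triple t Ht) as Hat.
    (* At both endpoints the logarithms reduce to those of m and (1-t)^2, whose difference is the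
       logarithm in the claim; its coefficient comes from m - (1-t)^2 = 3t. *)
    assert (HQ1 : Q 1 = m ^ 2) by (unfold Q, m; ring).
    assert (HQ0 : Q 0 = (1 - t) ^ 2 * m) by (unfold Q, m; ring).
    unfold Phi. rewrite HQ0, HQ1.
    replace (m - 3 * t * 1) with ((1 - t) ^ 2) by (unfold m; ring).
    replace (m - 3 * t * 0) with m by ring.
    rewrite Ht3, Ht3'.
    replace ((1 - t) * m / (1 - t) ^ 3) with (m / (1 - t) ^ 2) by (field; lra).
    assert (H1t : 0 < (1 - t) ^ 2) by nra.
    rewrite ln_div by lra. rewrite ln_mult by lra.
    replace (ln (m ^ 2)) with (2 * ln m)
      by (replace (m ^ 2) with (m * m) by ring; rewrite ln_mult by lra; ring).
    set (A1 := atan ((6 * t * 1 + (1 - t) ^ 2) / (sqrt 3 * (1 - t ^ 2)))) in *.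
    set (A0 := atan ((6 * t * 0 + (1 - t) ^ 2) / (sqrt 3 * (1 - t ^ 2)))) in *.
    set (A := atan (sqrt 3 * t / (2 + t))) in *.
    replace A1 with (3 * A + A0) by lra.
    set (l1 := ln m). set (l2 := ln ((1 - t) ^ 2)).
    transitivity (m / (3 * n) * (l2 - l1) + (1 - t) ^ 2 / (3 * n) * (l1 - l2)
        + 2 * t * (1 - t) / (sqrt 3 * (1 + t) * n) * (3 * A)).
    + ring.
    + unfold m. field_simplify_eq; [ring [Hss]|lra].
Qed.

(** The sum of z^k / (k binom(3k,k)) over k >= 1, expressed in the parameter t with z = -27 t^3 /
    (1-t^3)^2. *)
Definition inv_binom_sum (t : R) : R :=
  2 * sqrt 3 * (t * (1 - t) / (1 + t ^ 3)) * atan (sqrt 3 * t / (2 + t))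
  - t * (1 + t) / (1 + t ^ 3) * ln ((1 - t ^ 3) / (1 - t) ^ 3).

Lemma Rabs_pow3_lt_1 (t : R) : Rabs (t ^ 3) < 1 -> -1 < t < 1.
Proof.
  intro H. apply Rabs_lt_between in H. split.
  - apply Rnot_le_lt. intro. assert (0 <= (t + 1) ^ 2) by apply pow2_ge_0. nra.
  - apply Rnot_le_lt. intro. nra.
Qed.

(** The second hypothesis says exactly that |z| < 27/4. The first one selects, among t and 1/t, the
    root for which the closed form holds. *)
Lemma is_series_inv_binom (t : R) :
  Rabs (t ^ 3) < 1 -> 4 * Rabs (t ^ 3) < (1 - t ^ 3) ^ 2 ->
  is_series (fun n => (-27 * t ^ 3 / (1 - t ^ 3) ^ 2) ^ S n
                      / (INR (S n) * Binomial.C (3 * S n) (S n)))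
    (inv_binom_sum t).
Proof.
  intros H1 H4.
  apply is_series_inv_binom_RInt; [|apply is_RInt_inv_binom_kernel, Rabs_pow3_lt_1, H1].
  assert (0 < (1 - t ^ 3) ^ 2) by (pose proof (Rabs_pos (t ^ 3)); lra).
  unfold Rdiv. rewrite !Rabs_mult, (Rabs_left (-27)) by lra.
  rewrite (Rabs_pos_eq (/ _)) by (left; apply Rinv_0_lt_compat; lra).
  apply Rmult_lt_reg_r with ((1 - t ^ 3) ^ 2); [lra|].
  rewrite Rmult_assoc, Rinv_l by lra. lra.
Qed.

(** * Real cube roots *)

Lemma Rpower_third_pow3 (t : R) : 0 < t -> Rpower t (1 / 3) ^ 3 = t.
Proof.
  intro H. rewrite <- Rpower_pow by apply exp_pos.
  rewrite Rpower_mult. replace (1 / 3 * INR 3) with 1 by (simpl; field).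
  now apply Rpower_1.
Qed.

Lemma cbrt_pow3 (t : R) : cbrt t ^ 3 = t.
Proof.
  unfold cbrt. destruct (Rlt_dec 0 t) as [H|H]; [now apply Rpower_third_pow3|].
  destruct (Rlt_dec t 0) as [H'|H'].
  - replace ((- Rpower (- t) (1 / 3)) ^ 3) with (- Rpower (- t) (1 / 3) ^ 3) by ring.
    rewrite Rpower_third_pow3 by lra. ring.
  - replace t with 0 by lra. ring.
Qed.

Lemma pow3_inj (x y : R) : x ^ 3 = y ^ 3 -> x = y.
Proof.
  intro H. destruct (Req_dec x y) as [|N]; [assumption|exfalso].
  assert (E : (x - y) * ((x + y / 2) ^ 2 + 3 / 4 * y ^ 2) = 0) by lra.
  apply Rmult_integral in E. destruct E as [E|E]; [lra|].
  assert (0 <= (x + y / 2) ^ 2) by apply pow2_ge_0.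
  assert (0 <= y ^ 2) by apply pow2_ge_0.
  assert (y = 0) by nra. subst. assert (x = 0) by nra. lra.
Qed.

Lemma cbrt_mult (x y : R) : cbrt (x * y) = cbrt x * cbrt y.
Proof. apply pow3_inj. now rewrite Rpow_mult_distr, !cbrt_pow3. Qed.

(** * The golden ratio and Binet's formulas for integer indices *)

Lemma sqrt5_sqr : sqrt 5 ^ 2 = 5.
Proof. apply pow2_sqrt; lra. Qed.

Lemma sqrt5_bounds : 2.236 < sqrt 5 < 2.2361.
Proof.
  pose proof sqrt5_sqr. assert (0 < sqrt 5) by (apply sqrt_lt_R0; lra). nra.
Qed.

Lemma alpha_mult_beta : alpha * beta = -1.
Proof. unfold alpha, beta. pose proof sqrt5_sqr. nra. Qed.

Lemma alpha_sqr : alpha ^ 2 = alpha + 1.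
Proof. unfold alpha. pose proof sqrt5_sqr. nra. Qed.

Lemma beta_sqr : beta ^ 2 = beta + 1.
Proof. unfold beta. pose proof sqrt5_sqr. nra. Qed.

Lemma alpha_neq_0 : alpha <> 0.
Proof. unfold alpha. pose proof sqrt5_bounds. lra. Qed.

Lemma beta_neq_0 : beta <> 0.
Proof. unfold beta. pose proof sqrt5_bounds. lra. Qed.

Lemma nat_ind2 (P : nat -> Prop) :
  P 0%nat -> P 1%nat -> (forall n, P n -> P (S n) -> P (S (S n))) -> forall n, P n.
Proof.
  intros H0 H1 H2 n. assert (P n /\ P (S n)) as [H _]; [|exact H].
  induction n as [|n [IH1 IH2]]; auto.
Qed.

Lemma fibn_binet (n : nat) : sqrt 5 * fibn n = alpha ^ n - beta ^ n.
Proof.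
  induction n as [| |n IH1 IH2] using nat_ind2.
  - simpl; ring.
  - simpl. unfold alpha, beta. field.
  - change (fibn (S (S n))) with (fibn (S n) + fibn n).
    replace (alpha ^ S (S n)) with (alpha ^ n * alpha ^ 2) by (simpl; ring).
    replace (beta ^ S (S n)) with (beta ^ n * beta ^ 2) by (simpl; ring).
    rewrite alpha_sqr, beta_sqr, Rmult_plus_distr_l, IH1, IH2. simpl; ring.
Qed.

Lemma lucn_binet (n : nat) : lucn n = alpha ^ n + beta ^ n.
Proof.
  induction n as [| |n IH1 IH2] using nat_ind2.
  - simpl; ring.
  - simpl. unfold alpha, beta. field.
  - change (lucn (S (S n))) with (lucn (S n) + lucn n).
    replace (alpha ^ S (S n)) with (alpha ^ n * alpha ^ 2) by (simpl; ring).
    replace (beta ^ S (S n)) with (beta ^ n * beta ^ 2) by (simpl; ring).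
    rewrite alpha_sqr, beta_sqr, IH1, IH2. simpl; ring.
Qed.

Lemma pow_opp1_sqr (n : nat) : (-1) ^ n * (-1) ^ n = 1.
Proof. rewrite <- Rpow_mult_distr. replace (-1 * -1) with 1 by ring. apply pow1. Qed.

Lemma powerRZ_opp_nat (x : R) (n : nat) : powerRZ x (- Z.of_nat n) = (/ x) ^ n.
Proof. now rewrite powerRZ_neg', <- pow_powerRZ, pow_inv. Qed.

Lemma powerRZ_mul_nat (x : R) (n : Z) (k : nat) : x <> 0 ->
  powerRZ x (n * Z.of_nat k) = powerRZ x n ^ k.
Proof.
  intro Hx. induction k as [|k IH]; [now rewrite Z.mul_0_r|].
  replace (n * Z.of_nat (S k))%Z with (n + n * Z.of_nat k)%Z by lia.
  now rewrite powerRZ_add, IH by assumption.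
Qed.

Lemma inv_alpha : / alpha = - beta.
Proof.
  apply Rmult_eq_reg_l with alpha; [|apply alpha_neq_0].
  rewrite Rinv_r by apply alpha_neq_0. pose proof alpha_mult_beta. lra.
Qed.

Lemma inv_beta : / beta = - alpha.
Proof.
  apply Rmult_eq_reg_l with beta; [|apply beta_neq_0].
  rewrite Rinv_r by apply beta_neq_0. pose proof alpha_mult_beta. lra.
Qed.

Lemma pow_opp (x : R) (n : nat) : (- x) ^ n = (-1) ^ n * x ^ n.
Proof. rewrite <- Rpow_mult_distr. f_equal. ring. Qed.

Lemma Fib_nonneg (n : nat) : Fib (Z.of_nat n) = fibn n.
Proof. unfold Fib. rewrite (proj2 (Z.leb_le _ _)), Nat2Z.id by lia. reflexivity. Qed.

Lemma Fib_neg (n : nat) : Fib (- Z.of_nat (S n)) = (-1) ^ n * fibn (S n).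
Proof.
  unfold Fib. rewrite (proj2 (Z.leb_gt _ _)) by lia.
  rewrite Z.opp_involutive, Nat2Z.id. now replace (S n - 1)%nat with n by lia.
Qed.

Lemma Luc_nonneg (n : nat) : Luc (Z.of_nat n) = lucn n.
Proof. unfold Luc. rewrite (proj2 (Z.leb_le _ _)), Nat2Z.id by lia. reflexivity. Qed.

Lemma Luc_neg (n : nat) : Luc (- Z.of_nat (S n)) = (-1) ^ S n * lucn (S n).
Proof.
  unfold Luc. rewrite (proj2 (Z.leb_gt _ _)) by lia.
  now rewrite Z.opp_involutive, Nat2Z.id.
Qed.

Lemma Z_nat_cases (n : Z) : (exists k, n = Z.of_nat k) \/ (exists k, n = (- Z.of_nat (S k))%Z).
Proof.
  destruct (Z_le_gt_dec 0 n).
  - left. exists (Z.to_nat n). lia.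
  - right. exists (Z.to_nat (- n - 1)). lia.
Qed.

(** Negative indices reduce to natural ones because inversion sends [alpha] to -[beta] and [beta] to
    -[alpha]; the resulting signs are those built into [Fib]. *)
Lemma Fib_binet (n : Z) : sqrt 5 * Fib n = powerRZ alpha n - powerRZ beta n.
Proof.
  destruct (Z_nat_cases n) as [[k ->]|[k ->]].
  - now rewrite Fib_nonneg, fibn_binet, <- !pow_powerRZ.
  - rewrite Fib_neg, !powerRZ_opp_nat, inv_alpha, inv_beta, (pow_opp alpha), (pow_opp beta).
    transitivity ((-1) ^ k * (sqrt 5 * fibn (S k))); [ring|].
    rewrite fibn_binet. simpl; ring.
Qed.

Lemma Luc_binet (n : Z) : Luc n = powerRZ alpha n + powerRZ beta n.
Proof.
  destruct (Z_nat_cases n) as [[k ->]|[k ->]].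
  - now rewrite Luc_nonneg, lucn_binet, <- !pow_powerRZ.
  - rewrite Luc_neg, !powerRZ_opp_nat, inv_alpha, inv_beta, (pow_opp alpha), (pow_opp beta),
      lucn_binet. ring.
Qed.

(** * Size of the two cubed parameters, for convergence *)

Lemma fibn_ge_1 (n : nat) : (1 <= n)%nat -> 1 <= fibn n.
Proof.
  assert (H : forall n, 1 <= fibn (S n) /\ 0 <= fibn n).
  { clear. induction n as [|n [IH1 IH2]]; [simpl; lra|].
    change (fibn (S (S n))) with (fibn (S n) + fibn n). lra. }
  intro Hn. destruct n as [|n]; [lia|]. apply H.
Qed.

Lemma fibn_ge_2 (n : nat) : (3 <= n)%nat -> 2 <= fibn n.
Proof.
  intro Hn. destruct n as [|[|n]]; try lia.
  change (fibn (S (S n))) with (fibn (S n) + fibn n).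
  pose proof (fibn_ge_1 (S n)). pose proof (fibn_ge_1 n).
  assert (1 <= n)%nat by lia. assert (1 <= S n)%nat by lia. intuition lra.
Qed.

Lemma opp_beta_bounds : 0.618 < - beta < 0.61805.
Proof. unfold beta. pose proof sqrt5_bounds. lra. Qed.

(** By Binet and -[beta] * [alpha] = 1, the product times sqrt 5 is 1 - (-beta^2)^m, which is at
    most 2 < sqrt 5. *)
Lemma opp_beta_pow_fibn (m : nat) : (1 <= m)%nat -> 0 < (- beta) ^ m * fibn m <= 1.
Proof.
  intro Hm. pose proof opp_beta_bounds. pose proof (fibn_ge_1 m Hm). split.
  - apply Rmult_lt_0_compat; [apply pow_lt; lra|lra].
  - assert (E : sqrt 5 * ((- beta) ^ m * fibn m) = 1 - (- beta ^ 2) ^ m).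
    { transitivity ((- beta) ^ m * (sqrt 5 * fibn m)); [ring|].
      rewrite fibn_binet.
      replace 1 with (((- beta) * alpha) ^ m).
      - replace (- beta ^ 2) with (- beta * beta) by ring.
        rewrite !(Rpow_mult_distr (- beta)). ring.
      - rewrite <- (pow1 m). f_equal. pose proof alpha_mult_beta. lra. }
    assert (Rabs ((- beta ^ 2) ^ m) <= 1).
    { rewrite <- RPow_abs, <- (pow1 m). apply pow_incr. split; [apply Rabs_pos|].
      apply Rabs_le. nra. }
    apply Rabs_le_between in H1. pose proof sqrt5_bounds. nra.
Qed.

(* With p = -m and q = m + n this is beta^q F_p / F_(p+q), while exchanging m and n gives
   F_(p+q) / (alpha^q F_p). *)
Definition fib_ratio (m n : nat) : R := - (beta ^ n / fibn n * ((- beta) ^ m * fibn m)).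

(* [0.17] is just below [3 - 2 * sqrt 2], the smaller root of [(1 - y)^2 = 4 y]. *)
Lemma fib_ratio_bounds (m n : nat) : (1 <= m)%nat -> (2 <= n)%nat ->
  -1 < fib_ratio m n <= 0.17.
Proof.
  intros Hm Hn. unfold fib_ratio.
  pose proof (opp_beta_pow_fibn m Hm) as Hw. set (w := _ * fibn m) in *. clearbody w.
  pose proof opp_beta_bounds as Hb.
  (* For n = 2 the factor beta^2 / F_2 is about 0.38, too large for the upper bound in absolute
     value, but the even exponent makes the ratio negative. From n = 3 on, |beta|^n <= 0.24 and F_n
     >= 2 give absolute value at most 0.12. *)
  destruct (Nat.eq_dec n 2) as [->|Hn2].
  - replace (beta ^ 2 / fibn 2) with (beta ^ 2) by (simpl; field).
    assert (0 < beta ^ 2 < 1) by nra. nra.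
  - assert (Hf : 2 <= fibn n) by (apply fibn_ge_2; lia).
    assert (Hp : Rabs (beta ^ n) <= 0.24).
    { rewrite <- RPow_abs, Rabs_left by lra.
      replace n with (3 + (n - 3))%nat by lia. rewrite pow_add.
      assert (0 <= (- beta) ^ (n - 3) <= 1).
      { split; [apply pow_le; lra|]. rewrite <- (pow1 (n - 3)). apply pow_incr. lra. }
      assert (0 <= (- beta) ^ 3 <= 0.24) by (simpl; nra). nra. }
    assert (Hr : Rabs (beta ^ n / fibn n) <= 0.12).
    { unfold Rdiv. rewrite Rabs_mult, Rabs_inv, (Rabs_pos_eq (fibn n)) by lra.
      apply Rmult_le_reg_r with (fibn n); [lra|].
      rewrite Rmult_assoc, Rinv_l by lra. nra. }
    apply Rabs_le_between in Hr. nra.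
Qed.

(** For negative y the second inequality amounts to (1+y)^2 > 0, so only positive y calls for the
    sharper bound. *)
Lemma convergence_domain (y : R) : -1 < y <= 0.17 -> Rabs y < 1 /\ 4 * Rabs y < (1 - y) ^ 2.
Proof.
  intro H. split; [apply Rabs_lt_between; lra|].
  destruct (Rle_dec 0 y); [rewrite Rabs_pos_eq by lra|rewrite Rabs_left by lra]; nra.
Qed.

Lemma Fib_ratio_beta (m n : nat) : (1 <= m)%nat -> (1 <= n)%nat ->
  powerRZ beta (Z.of_nat (m + n)) * Fib (- Z.of_nat m) / Fib (Z.of_nat n) = fib_ratio m n.
Proof.
  intros Hm Hn. pose proof (fibn_ge_1 n Hn).
  destruct m as [|k]; [lia|].
  rewrite Fib_neg, Fib_nonneg, <- pow_powerRZ, pow_add. unfold fib_ratio.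
  rewrite (pow_opp beta). rewrite <- (tech_pow_Rmult (-1)). field. lra.
Qed.

Lemma Fib_ratio_alpha (m n : nat) : (1 <= m)%nat -> (1 <= n)%nat ->
  Fib (Z.of_nat n) / (powerRZ alpha (Z.of_nat (m + n)) * Fib (- Z.of_nat m)) = fib_ratio n m.
Proof.
  intros Hm Hn. pose proof (fibn_ge_1 m Hm).
  destruct m as [|k]; [lia|].
  rewrite Fib_neg, Fib_nonneg, <- pow_powerRZ, pow_add. unfold fib_ratio.
  assert (Ha : forall j, alpha ^ j <> 0) by (intro; apply pow_nonzero, alpha_neq_0).
  assert (Hinv : forall j, (- beta) ^ j = / alpha ^ j)
    by (intro; rewrite <- inv_alpha; apply pow_inv).
  assert (Hb : beta ^ S k = (-1) ^ S k * / alpha ^ S k).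
  { rewrite <- Hinv, (pow_opp beta), <- Rmult_assoc, pow_opp1_sqr. ring. }
  rewrite Hb, Hinv, <- (tech_pow_Rmult (-1)).
  pose proof (pow_opp1_sqr k) as Hk.
  assert (He : (-1) ^ k <> 0) by (apply pow_nonzero; lra).
  (* The sign (-1)^k stands in a denominator on the left and in a numerator on the right; writing 1
     as its square lets [field] match the two. *)
  rewrite <- (Rmult_1_r (fibn n)) at 1. rewrite <- Hk. field.
  repeat split; auto; lra.
Qed.

(** * The closed form in terms of cube roots *)

(** Here a, b, c stand for the cube roots of F_p, F_(p+q) and alpha^q. Substituting b = t c a makes
    every fraction homogeneous in c a, and what remains is rational algebra with the arctangent and
    the logarithm as opaque terms. *)
Lemma inv_binom_sum_alpha (a b c : R) :
  a <> 0 -> b <> 0 -> c <> 0 -> -1 < b / (c * a) < 1 ->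
  / (a * b) * inv_binom_sum (b / (c * a)) =
  2 * sqrt 3 * (c * ((c * a + -1 * b) / (c ^ 3 * a ^ 3 + b ^ 3))
    * atan (sqrt 3 * b / (2 * (c * a) + b)))
  - c * ((c * a + 1 * b) / (c ^ 3 * a ^ 3 + b ^ 3))
    * ln ((b ^ 3 - c ^ 3 * a ^ 3) / (b - c * a) ^ 3).
Proof.
  intros Ha Hb Hc Ht. unfold inv_binom_sum.
  set (t := b / (c * a)) in *.
  assert (Hca : c * a <> 0) by (apply Rmult_integral_contrapositive; auto).
  assert (Eb : b = t * (c * a)) by (unfold t; field; auto).
  assert (Ht0 : t <> 0) by (intro E; apply Hb; rewrite Eb, E; ring).
  assert (H1 : 1 + t ^ 3 <> 0)
    by (assert (0 < (1 + t) * (1 - t + t ^ 2)) by (apply Rmult_lt_0_compat; nra); nra).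
  clearbody t. subst b.
  replace (sqrt 3 * (t * (c * a)) / (2 * (c * a) + t * (c * a)))
    with (sqrt 3 * t / (2 + t)).
  2:{ field. repeat split; try lra; auto.
      replace (2 * (c * a) + t * (c * a)) with ((2 + t) * (c * a)) by ring.
      apply Rmult_integral_contrapositive; split; [lra|exact Hca]. }
  replace (((t * (c * a)) ^ 3 - c ^ 3 * a ^ 3) / (t * (c * a) - c * a) ^ 3)
    with ((1 - t ^ 3) / (1 - t) ^ 3).
  2:{ field. repeat split; try lra; auto.
      replace (t * (c * a) - c * a) with ((t - 1) * (c * a)) by ring.
      apply Rmult_integral_contrapositive; split; [lra|exact Hca]. }
  set (A := atan _). set (L := ln _). clearbody A L.
  replace (c ^ 3 * a ^ 3 + (t * (c * a)) ^ 3) with ((1 + t ^ 3) * (c * a) ^ 3) by ring.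
  field. auto.
Qed.

(** Now d is the cube root of beta^q and e = (-1)^q. The relation e c = 1/d is what brings alpha^q
    into the second arctangent. Since d a - b = (t-1) b, the arctangent term changes sign compared
    with the [alpha] case while the logarithmic term does not. *)
Lemma inv_binom_sum_beta (a b c d e : R) :
  a <> 0 -> b <> 0 -> c * d = e -> e * e = 1 -> -1 < d * a / b < 1 ->
  / (a * b) * inv_binom_sum (d * a / b) =
  - (2 * sqrt 3 * (d * ((d * a + -1 * b) / (d ^ 3 * a ^ 3 + b ^ 3))
    * atan (sqrt 3 * a / (2 * e * (c * b) + a))))
  - d * ((d * a + 1 * b) / (d ^ 3 * a ^ 3 + b ^ 3))
    * ln ((b ^ 3 - d ^ 3 * a ^ 3) / (b - d * a) ^ 3).
Proof.
  intros Ha Hb Hcd He Ht. unfold inv_binom_sum.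
  assert (Hd : d <> 0) by (intros ->; nra).
  set (t := d * a / b) in *.
  assert (Ea : a = t * b / d) by (unfold t; field; auto).
  assert (Ht0 : t <> 0).
  { intro E. apply Ha. rewrite Ea, E. field. exact Hd. }
  assert (H1 : 1 + t ^ 3 <> 0)
    by (assert (0 < (1 + t) * (1 - t + t ^ 2)) by (apply Rmult_lt_0_compat; nra); nra).
  assert (Hec : e * c = / d).
  { apply Rmult_eq_reg_r with d; [|exact Hd]. rewrite Rinv_l by exact Hd. nra. }
  clearbody t. subst a.
  replace (2 * e * (c * b)) with (2 * b * / d) by (rewrite <- Hec; ring).
  replace (sqrt 3 * (t * b / d) / (2 * b * / d + t * b / d))
    with (sqrt 3 * t / (2 + t)).
  2:{ field. repeat split; try lra; auto.
      replace (2 * b + t * b) with ((2 + t) * b) by ring.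
      apply Rmult_integral_contrapositive; split; [lra|exact Hb]. }
  replace ((b ^ 3 - d ^ 3 * (t * b / d) ^ 3) / (b - d * (t * b / d)) ^ 3)
    with ((1 - t ^ 3) / (1 - t) ^ 3).
  2:{ replace (d * (t * b / d)) with (t * b) by (field; auto).
      replace (d ^ 3 * (t * b / d) ^ 3) with ((t * b) ^ 3) by (field; auto).
      field. repeat split; try lra; auto.
      replace (b - t * b) with ((1 - t) * b) by ring.
      apply Rmult_integral_contrapositive; split; [lra|exact Hb]. }
  set (A := atan _). set (L := ln _). clearbody A L.
  replace (d ^ 3 * (t * b / d) ^ 3 + b ^ 3) with ((1 + t ^ 3) * b ^ 3) by (field; auto).
  field. auto.
Qed.

(** * Assembly of the Fibonacci and Lucas series *)

Theorem theorem9 (p q : Z) (hp : (p <= -2)%Z) (hq : (4 <= q)%Z)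
  (hpq : (Z.abs p + 1 < q)%Z) :
  (ex_series (fun n : nat => term Fib p q (S n)) /\
   sqrt 5 / cbrt (Fib p * Fib (p + q)) * Series (fun n : nat => term Fib p q (S n)) =
   2 * sqrt 3 * (Acoef p q alpha (-1) * atan1 p q + Acoef p q beta (-1) * atan2' p q)
   - (Acoef p q alpha 1 * log1 p q - Acoef p q beta 1 * log2 p q)) /\
  (ex_series (fun n : nat => term Luc p q (S n)) /\
   1 / cbrt (Fib p * Fib (p + q)) * Series (fun n : nat => term Luc p q (S n)) =
   2 * sqrt 3 * (Acoef p q alpha (-1) * atan1 p q - Acoef p q beta (-1) * atan2' p q)
   - (Acoef p q alpha 1 * log1 p q + Acoef p q beta 1 * log2 p q)).
Proof.
  set (a := cbrt (Fib p)). set (b := cbrt (Fib (p + q))).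
  set (c := cbrt (powerRZ alpha q)). set (d := cbrt (powerRZ beta q)).
  set (e := powerRZ (-1) q).
  assert (Ha3 : a ^ 3 = Fib p) by apply cbrt_pow3.
  assert (Hb3 : b ^ 3 = Fib (p + q)) by apply cbrt_pow3.
  assert (Hc3 : c ^ 3 = powerRZ alpha q) by apply cbrt_pow3.
  assert (Hd3 : d ^ 3 = powerRZ beta q) by apply cbrt_pow3.
  (* With m = -p and n = p + q, the hypotheses give m >= 2 and n >= 2. [fib_ratio_bounds] uses the
     first for the [alpha] parameter and the second for the [beta] one. *)
  destruct (Z_of_nat_complete (- p)) as [m Hm]; [lia|].
  destruct (Z_of_nat_complete (p + q)) as [n Hn]; [lia|].
  assert (Hp : p = (- Z.of_nat m)%Z) by lia.
  assert (Hq : q = Z.of_nat (m + n)) by lia.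
  assert (Hfp : Fib p <> 0).
  { rewrite Hp. destruct m as [|k]; [lia|]. rewrite Fib_neg.
    pose proof (fibn_ge_1 (S k)). apply Rmult_integral_contrapositive.
    split; [apply pow_nonzero; lra|]. assert (1 <= S k)%nat by lia. intuition lra. }
  assert (Hfpq : Fib (p + q) <> 0).
  { rewrite Hn, Fib_nonneg. pose proof (fibn_ge_1 n). assert (1 <= n)%nat by lia. intuition lra. }
  assert (Hfq : Fib q <> 0).
  { rewrite Hq, Fib_nonneg. pose proof (fibn_ge_1 (m + n)).
    assert (1 <= m + n)%nat by lia. intuition lra. }
  assert (Ha : a <> 0) by (intro E; apply Hfp; rewrite <- Ha3, E; ring).
  assert (Hb : b <> 0) by (intro E; apply Hfpq; rewrite <- Hb3, E; ring).
  assert (Haq : forall k, powerRZ alpha k <> 0) by (intro; apply powerRZ_NOR, alpha_neq_0).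
  assert (Hbq : forall k, powerRZ beta k <> 0) by (intro; apply powerRZ_NOR, beta_neq_0).
  assert (Hc : c <> 0) by (intro E; apply (Haq q); rewrite <- Hc3, E; ring).
  (* The product c d is the cube root of (alpha beta)^q = (-1)^q, and a number of square 1 is its
     own cube. *)
  assert (Hcd : c * d = e).
  { unfold c, d. rewrite <- cbrt_mult, <- powerRZ_mult, alpha_mult_beta. fold e.
    apply pow3_inj. rewrite cbrt_pow3. unfold e. rewrite Hq, <- pow_powerRZ.
    set (s := (-1) ^ (m + n)). replace (s ^ 3) with (s * (s * s)) by ring.
    unfold s at 3 4. rewrite pow_opp1_sqr. ring. }
  assert (He : e * e = 1) by (unfold e; rewrite Hq, <- pow_powerRZ; apply pow_opp1_sqr).
  set (ta := b / (c * a)). set (tb := d * a / b).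
  assert (Hta3 : ta ^ 3 = Fib (p + q) / (powerRZ alpha q * Fib p)).
  { unfold ta. rewrite <- Ha3, <- Hb3, <- Hc3. field. auto. }
  assert (Htb3 : tb ^ 3 = powerRZ beta q * Fib p / Fib (p + q)).
  { unfold tb. rewrite <- Ha3, <- Hb3, <- Hd3. field. auto. }
  destruct (convergence_domain (ta ^ 3)) as [Ha1 Ha2].
  { rewrite Hta3, Hn, Hp, Hq, Fib_ratio_alpha by lia. apply fib_ratio_bounds; lia. }
  destruct (convergence_domain (tb ^ 3)) as [Hb1 Hb2].
  { rewrite Htb3, Hn, Hp, Hq, Fib_ratio_beta by lia. apply fib_ratio_bounds; lia. }
  assert (Hs5 : sqrt 5 <> 0) by (pose proof sqrt5_bounds; lra).
  assert (Hda : Fib (p + q) - powerRZ alpha q * Fib p = powerRZ beta p * Fib q).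
  { apply Rmult_eq_reg_l with (sqrt 5); [|exact Hs5].
    transitivity (sqrt 5 * Fib (p + q) - powerRZ alpha q * (sqrt 5 * Fib p)); [ring|].
    transitivity (powerRZ beta p * (sqrt 5 * Fib q)); [|ring].
    rewrite !Fib_binet, !powerRZ_add by (apply alpha_neq_0 || apply beta_neq_0). ring. }
  assert (Hdb : Fib (p + q) - powerRZ beta q * Fib p = powerRZ alpha p * Fib q).
  { apply Rmult_eq_reg_l with (sqrt 5); [|exact Hs5].
    transitivity (sqrt 5 * Fib (p + q) - powerRZ beta q * (sqrt 5 * Fib p)); [ring|].
    transitivity (powerRZ alpha p * (sqrt 5 * Fib q)); [|ring].
    rewrite !Fib_binet, !powerRZ_add by (apply alpha_neq_0 || apply beta_neq_0). ring. }
  set (w := -27 * Fib p * Fib (p + q) / Fib q ^ 2).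
  (* This turns the square of beta^p in the denominator of z into alpha^(2p), and conversely, so
     that the two values of z are w alpha^(2p+q) and w beta^(2p+q), as Binet's formula requires. *)
  assert (Hab : powerRZ alpha p ^ 2 * powerRZ beta p ^ 2 = 1).
  { rewrite <- Rpow_mult_distr, <- powerRZ_mult, alpha_mult_beta, Hp, powerRZ_opp_nat.
    replace (/ -1) with (-1) by field. simpl. rewrite Rmult_1_r. apply pow_opp1_sqr. }
  assert (H2p : forall x, x <> 0 -> powerRZ x (2 * p + q) = powerRZ x p ^ 2 * powerRZ x q).
  { intros x Hx. rewrite powerRZ_add by exact Hx. f_equal.
    replace (2 * p)%Z with (p * Z.of_nat 2)%Z by lia. now apply powerRZ_mul_nat. }
  assert (Hwa : -27 * ta ^ 3 / (1 - ta ^ 3) ^ 2 = w * powerRZ alpha (2 * p + q)).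
  { rewrite H2p by apply alpha_neq_0.
    replace (powerRZ alpha p ^ 2) with (/ powerRZ beta p ^ 2)
      by (apply Rmult_eq_reg_r with (powerRZ beta p ^ 2);
          [rewrite Rinv_l, Hab; auto using pow_nonzero|auto using pow_nonzero]).
    transitivity (-27 * (powerRZ alpha q * Fib p * Fib (p + q))
                  / (Fib (p + q) - powerRZ alpha q * Fib p) ^ 2).
    - rewrite Hta3. field. rewrite Hda. repeat split; auto.
      replace (powerRZ alpha q * Fib p - Fib (p + q)) with (- (powerRZ beta p * Fib q))
        by (rewrite <- Hda; ring).
      apply Ropp_neq_0_compat, Rmult_integral_contrapositive; auto.
    - rewrite Hda. unfold w. field. auto. }
  assert (Hwb : -27 * tb ^ 3 / (1 - tb ^ 3) ^ 2 = w * powerRZ beta (2 * p + q)).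
  { rewrite H2p by apply beta_neq_0.
    replace (powerRZ beta p ^ 2) with (/ powerRZ alpha p ^ 2)
      by (apply Rmult_eq_reg_l with (powerRZ alpha p ^ 2);
          [rewrite Rinv_r, Hab; auto using pow_nonzero|auto using pow_nonzero]).
    transitivity (-27 * (powerRZ beta q * Fib p * Fib (p + q))
                  / (Fib (p + q) - powerRZ beta q * Fib p) ^ 2).
    - rewrite Htb3. field. rewrite Hdb. split; auto.
    - rewrite Hdb. unfold w. field. auto. }
  pose proof (is_series_inv_binom ta Ha1 Ha2) as Sa.
  pose proof (is_series_inv_binom tb Hb1 Hb2) as Sb.
  rewrite Hwa in Sa. rewrite Hwb in Sb.
  assert (SF : is_series (fun k => term Fib p q (S k))
                 (/ sqrt 5 * (inv_binom_sum ta - inv_binom_sum tb))).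
  { eapply is_series_ext; [|exact (is_series_scal (/ sqrt 5) _ _ (is_series_minus _ _ _ _ Sa Sb))].
    intro k. unfold term. fold w.
    set (D := INR (S k) * Binomial.C (3 * S k) (S k)).
    change (/ sqrt 5 * ((w * powerRZ alpha (2 * p + q)) ^ S k / D - (w * powerRZ beta (2 * p + q)) ^ S k / D)
      = w ^ S k * Fib ((2 * p + q) * Z.of_nat (S k)) / D).
    rewrite !Rpow_mult_distr, <- !powerRZ_mul_nat by (apply alpha_neq_0 || apply beta_neq_0).
    unfold Rdiv. transitivity (/ sqrt 5 * (w ^ S k * (sqrt 5 * Fib ((2 * p + q) * Z.of_nat (S k))) * / D)).
    - rewrite Fib_binet. ring.
    - set (D' := / D). field. exact Hs5. }
  assert (SL : is_series (fun k => term Luc p q (S k)) (inv_binom_sum ta + inv_binom_sum tb)).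
  { eapply is_series_ext; [|exact (is_series_plus _ _ _ _ Sa Sb)].
    intro k. unfold term. fold w.
    set (D := INR (S k) * Binomial.C (3 * S k) (S k)).
    change ((w * powerRZ alpha (2 * p + q)) ^ S k / D + (w * powerRZ beta (2 * p + q)) ^ S k / D
      = w ^ S k * Luc ((2 * p + q) * Z.of_nat (S k)) / D).
    rewrite !Rpow_mult_distr, <- !powerRZ_mul_nat by (apply alpha_neq_0 || apply beta_neq_0).
    rewrite Luc_binet. unfold Rdiv. ring. }
  assert (Ia : / (a * b) * inv_binom_sum ta =
    2 * sqrt 3 * (Acoef p q alpha (-1) * atan1 p q) - Acoef p q alpha 1 * log1 p q).
  { unfold Acoef, atan1, log1. rewrite !cbrt_mult. fold a b c.
    rewrite <- Hda, <- Ha3, <- Hb3, <- Hc3.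
    apply inv_binom_sum_alpha; auto. now apply Rabs_pow3_lt_1. }
  assert (Ib : / (a * b) * inv_binom_sum tb =
    - (2 * sqrt 3 * (Acoef p q beta (-1) * atan2' p q)) - Acoef p q beta 1 * log2 p q).
  { unfold Acoef, atan2', log2. rewrite !cbrt_mult. fold a b c d e.
    rewrite <- Hdb, <- Ha3, <- Hb3, <- Hd3.
    apply inv_binom_sum_beta; auto. now apply Rabs_pow3_lt_1. }
  rewrite (is_series_unique _ _ SF), (is_series_unique _ _ SL), cbrt_mult. fold a b.
  split; (split; [eexists; eassumption|]).
  - transitivity (/ (a * b) * inv_binom_sum ta - / (a * b) * inv_binom_sum tb).
    + field. auto.
    + rewrite Ia, Ib. ring.
  - transitivity (/ (a * b) * inv_binom_sum ta + / (a * b) * inv_binom_sum tb).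
    + field. auto.
    + rewrite Ia, Ib. ring.
Qed.
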